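(* Let $G=(V,E)$ be a directed cactus graph with vertex set $V=\{1,2,\ldots,n\}$, i.e. a strongly connected simple digraph in which every directed edge is contained in exactly one directed cycle. Let $L$ be the Laplacian matrix of $G$, let $L^\dagger=(l^\dagger_{ij})$ be its Moore–Penrose inverse, and define the resistance $r_{ij}:=l^\dagger_{ii}+l^\dagger_{jj}-2l^\dagger_{ij}$ for $i,j\in V$. Let $d_{ij}$ denote the length of a shortest directed path from $i$ to $j$ (with $d_{ii}:=0$). Then $r_{ij}\le d_{ij}$ for all $i,j\in V$.
   Context: For a simple digraph $G=(V,E)$ on $V=\{1,\dots,n\}$, $(i,j)\in E$ means there is a directed edge from $i$ to $j$. The outdegree of $i$ is $\delta_i^{out}=|\{j:(i,j)\in E\}|$ and the indegree is $\delta_i^{in}=|\{j:(j,i)\in E\}|$. The Laplacian $L=(l_{ij})$ is defined by $l_{ii}=\delta_i^{out}$, $l_{ij}=-1$ if $i\neq j$ and $(i,j)\in E$, and $l_{ij}=0$ otherwise. A digraph is strongly connected if there is a directed path from any vertex to any other vertex. (A directed cactus is automatically balanced, i.e. $\delta_i^{in}=\delta_i^{out}$ for all $i$.) *)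

(* Defs.v *)
From mathcomp Require Import all_boot all_order all_algebra.

Set Implicit Arguments.
Unset Strict Implicit.
Unset Printing Implicit Defensive.

Import Order.TTheory GRing.Theory Num.Theory.

Local Open Scope ring_scope.

(* A simple digraph on 'I_n is an irreflexive relation e, with e i j meaning
   (i, j) \in E; both e i j and e j i may hold. *)

Definition outdeg (n : nat) (e : rel 'I_n) (i : 'I_n) : nat :=
  #|[set j | e i j]|.

Definition laplacian (R : pzRingType) (n : nat) (e : rel 'I_n) : 'M[R]_n :=
  \matrix_(i, j) (if i == j then (outdeg e i)%:R
                  else if e i j then -1 else 0).

Definition strongly_connected (n : nat) (e : rel 'I_n) : Prop :=
  forall i j, connect e i j.

(* A directed cycle is represented by its set of edges, so that the rotations
   of a cyclic sequence of vertices count as one cycle. The sequence c is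
   nonempty, and has at least two vertices when e is irreflexive. *)
Definition dicycle (n : nat) (e : rel 'I_n) (C : {set 'I_n * 'I_n}) : Prop :=
  exists c : seq 'I_n,
    [/\ c != [::], ucycle e c & C = [set (x, next c x) | x in c]].

Definition directed_cactus (n : nat) (e : rel 'I_n) : Prop :=
  [/\ irreflexive e,
      strongly_connected e
    & forall i j, e i j -> exists! C, dicycle e C /\ (i, j) \in C].

(* p lists the vertices after i, so the length of the path is size p. *)
Definition dipath (n : nat) (e : rel 'I_n) (i j : 'I_n) (p : seq 'I_n) : bool :=
  [&& path e i p, last i p == j & uniq (i :: p)].

(* The least k such that there is a directed path of length k from i to j, and
   n if there is none: paths have at most n vertices, hence length < n. *)
Definition didist (n : nat) (e : rel 'I_n) (i j : 'I_n) : nat :=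
  find (fun k => [exists p : k.-tuple 'I_n, dipath e i j p]) (iota 0 n).

Definition is_moore_penrose (R : realFieldType) (m n : nat)
    (A : 'M[R]_(m, n)) (X : 'M[R]_(n, m)) : Prop :=
  [/\ A *m X *m A = A,
      X *m A *m X = X,
      (A *m X)^T = A *m X
    & (X *m A)^T = X *m A].

(* The (i, j) resistance, given the Moore-Penrose inverse X of the Laplacian. *)
Definition resistance (R : realFieldType) (n : nat) (X : 'M[R]_n)
    (i j : 'I_n) : R :=
  X i i + X j j - 2 * X i j.

Lemma didistP (n : nat) (e : rel 'I_n) (i j : 'I_n) :
  connect e i j ->
  (exists2 p, dipath e i j p & size p = didist e i j) /\
  (forall p, dipath e i j p -> (didist e i j <= size p)%N).
Proof.
move=> cij; set a := fun k => [exists p : k.-tuple 'I_n, dipath e i j p].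
have szP p : dipath e i j p -> (size p < n)%N /\ a (size p).
  move=> hp; split; last by apply/existsP; exists (in_tuple p).
  case/and3P: hp => _ _ /card_uniqP /= <-.
  by rewrite -[n in (_ <= n)%N]card_ord max_card.
have le p : dipath e i j p -> (didist e i j <= size p)%N.
  move=> /szP[ltn ap]; rewrite leqNgt; apply/negP => /(before_find 0%N).
  by rewrite nth_iota // add0n -/(a (size p)) ap.
split=> //; case/connectP: cij => p0 /shortenP[p ep up _] jE.
have hp : dipath e i j p by rewrite /dipath ep up jE eqxx.
have [ltn ap] := szP p hp.
have lt : (didist e i j < n)%N := leq_ltn_trans (le p hp) ltn.
have : a (didist e i j).
  rewrite -[didist e i j]add0n -(@nth_iota 0%N 0 n) //; apply: nth_find.
  by rewrite has_find size_iota.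
by case/existsP => q hq; exists q; rewrite ?size_tuple.
Qed.

Lemma is_moore_penrose_unique (R : realFieldType) (m n : nat)
    (A : 'M[R]_(m, n)) (X Y : 'M[R]_(n, m)) :
  is_moore_penrose A X -> is_moore_penrose A Y -> X = Y.
Proof.
case=> x1 x2 x3 x4 [y1 y2 y3 y4].
have AXY : A *m X = A *m Y.
  rewrite -x3 -{1}y1 -mulmxA trmx_mul y3 x3 mulmxA x1; exact: erefl.
have XYA : X *m A = Y *m A.
  by rewrite -x4 -{1}y1 -mulmxA mulmxA trmx_mul y4 x4 -!mulmxA [A *m _]mulmxA x1.
by rewrite -x2 XYA -mulmxA AXY mulmxA y2.
Qed.

Lemma gram_unitmx (R : realFieldType) (m n : nat) (F : 'M[R]_(m, n)) :
  row_free F -> F *m F^T \in unitmx.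
Proof.
move=> fF; rewrite -row_free_unit; apply: inj_row_free => v v0.
apply/eqP; rewrite -(mulmx_free_eq0 v fF); apply/eqP/rowP => j.
have /matrixP/(_ 0 0) : (v *m F) *m (v *m F)^T = 0.
  by rewrite trmx_mul mulmxA -[v *m F *m _]mulmxA v0 mul0mx.
rewrite !mxE => /eqP; rewrite psumr_eq0 => [/allP/(_ j)|k _].
  by rewrite mem_index_enum !mxE mulf_eq0 orbb => /(_ isT)/eqP.
by rewrite !mxE -expr2 sqr_ge0.
Qed.

Lemma is_moore_penrose_exists (R : realFieldType) (m n : nat)
    (A : 'M[R]_(m, n)) :
  exists X, is_moore_penrose A X.
Proof.
have [r [C [F [-> uC uF]]]] : exists r (C : 'M[R]_(m, r)) (F : 'M_(r, n)),
    [/\ A = C *m F, C^T *m C \in unitmx & F *m F^T \in unitmx].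
  exists (\rank A), (col_base A), (row_base A); split.
  - by rewrite mulmx_base.
  - rewrite -[X in _ *m X]trmxK; apply: gram_unitmx.
    by rewrite /row_free mxrank_tr; exact: col_base_full.
  - exact/gram_unitmx/row_base_free.
set P := invmx (F *m F^T); set Q := invmx (C^T *m C).
have PT : P^T = P by rewrite trmx_inv trmx_mul trmxK.
have QT : Q^T = Q by rewrite trmx_inv trmx_mul trmxK.
pose X := F^T *m P *m (Q *m C^T).
have FFP : F *m F^T *m P = 1%:M by rewrite mulmxV.
have QCC : Q *m (C^T *m C) = 1%:M by rewrite mulVmx.
have AX : C *m F *m X = C *m (Q *m C^T).
  by rewrite /X -mulmxA !(mulmxA F) FFP mul1mx.
have XA : X *m (C *m F) = F^T *m P *m F.
  by rewrite /X -mulmxA (mulmxA _ C) -(mulmxA Q) QCC mul1mx.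
exists X; split.
- by rewrite AX -!mulmxA (mulmxA C^T) (mulmxA Q) QCC mul1mx.
- by rewrite XA /X -(mulmxA _ F) !(mulmxA F) FFP mul1mx.
- by rewrite AX !trmx_mul trmxK QT mulmxA.
- by rewrite XA !trmx_mul trmxK PT mulmxA.
Qed.

(* Main.v *)
Require Import Defs.
From mathcomp Require Import all_boot all_order all_algebra.
From mathcomp Require Import ring.

(* Every in-edge of a vertex v is followed by exactly one out-edge on its cycle
   (this is [matched]), so e is balanced, L 1 = 0 and 1^T L = 0. For an edge
   (i, j), let T be the set of vertices that reach j, and S the set of vertices
   reachable from i, once (i, j) is deleted. S and T are disjoint, (i, j) is the
   only edge entering T, and a single edge leaves T, from j; hence
   L 1_T = e_j - e_i, and dually for S. Applying the Moore-Penrose inverse gives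
   r_ij = (|S| + |T|) / n <= 1. The minimum principle for L gives the triangle
   inequality for r, and summing along a shortest path concludes. *)

Set Implicit Arguments.
Unset Strict Implicit.
Unset Printing Implicit Defensive.

Import Order.TTheory GRing.Theory Num.Theory.

Local Open Scope ring_scope.

(** * Reversal, vertex avoidance and consecutive edges of a cycle *)

Definition converse (T : Type) (e : rel T) : rel T := fun x y => e y x.

Definition avoid (T : eqType) (e : rel T) (v : T) : rel T :=
  fun x y => [&& e x y, x != v & y != v].

(** The edges (u, v) and (v, w) are consecutive on a directed cycle: a return path from [w] to [u]
    off [v] closes it up. The case [u = w] is a 2-cycle. *)
Definition matched (T : finType) (e : rel T) (v u w : T) : bool :=
  [&& e u v, e v w & connect (avoid e v) w u].

(** The form in which the cactus condition is used: at each vertex, in-edges and out-edges determine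
    each other. Unlike a statement about cycles, it is visibly stable under reversal. *)
Definition cycle_matching (T : finType) (e : rel T) : Prop :=
  forall v u u' w w',
    matched e v u w -> matched e v u' w' -> (u == u') = (w == w').

Definition remove_edge (T : eqType) (e : rel T) (i j : T) : rel T :=
  fun x y => e x y && ((x, y) != (i, j)).

Lemma connect_converse (T : finType) (e : rel T) (x y : T) :
  connect (converse e) x y = connect e y x.
Proof.
by rewrite (connect_rev e) /=; apply: eq_connect => a b.
Qed.

Lemma matched_converse (T : finType) (e : rel T) (v u w : T) :
  matched (converse e) v u w = matched e v w u.
Proof.
rewrite /matched /converse -(connect_converse (avoid e v)) andbCA.
congr [&& _, _ & _]; apply: eq_connect => x y.
by rewrite /avoid /converse [(y != v) && _]andbC.
Qed.

Lemma cycle_matching_converse (T : finType) (e : rel T) :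
  cycle_matching e -> cycle_matching (converse e).
Proof.
move=> Me v u u' w w'; rewrite 2!(matched_converse e) => m m'.
by rewrite (Me _ _ _ _ _ m m').
Qed.

(** A path with distinct vertices starting at [v] never returns to [v], so its tail avoids [v]. *)
Lemma connect_last_departure (T : finType) (e : rel T) (v x : T) :
  connect e v x -> v != x ->
  exists2 w, e v w & connect (avoid e v) w x.
Proof.
case/connectP => p0 /shortenP[[|w p] /= ep up _] ->; first by rewrite eqxx.
move=> _; case/andP: ep => evw ep; exists w => //.
apply/connectP; exists p => //; case/andP: up => vNp _.
move: vNp ep; elim: p w {evw} => //= y p IHp w.
rewrite !inE !negb_or => /and3P[vw vy vp] /andP[ewy ep].
rewrite IHp ?inE ?negb_or ?vy // andbT /avoid ewy.
by rewrite ![_ == v]eq_sym vw vy.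
Qed.

Lemma connect_first_arrival (T : finType) (e : rel T) (x v : T) :
  connect e x v -> x != v ->
  exists2 u, e u v & connect (avoid e v) x u.
Proof.
rewrite -(connect_converse e) eq_sym => cvx vx.
have [u euv cux] := connect_last_departure cvx vx.
exists u => //; rewrite -(connect_converse (avoid e v)).
by apply: connect_sub cux => a b /and3P[? ? ?]; apply/connect1/and3P; split.
Qed.

Lemma sub_connect_avoid (T : finType) (e e' : rel T) (v x y : T) :
  subrel e e' -> connect (avoid e v) x y -> connect (avoid e' v) x y.
Proof.
move=> see'; apply: connect_sub => a b /and3P[/see' ? ? ?].
by apply/connect1/and3P.
Qed.

Lemma sub_remove_edge (T : eqType) (e : rel T) (i j : T) :
  subrel (remove_edge e i j) e.
Proof. by move=> x y /andP[]. Qed.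

(** * From unique cycles to the matching of edges *)

Lemma matched_dicycle (n : nat) (e : rel 'I_n) (v u w : 'I_n) :
  irreflexive e -> matched e v u w ->
  exists C, [/\ dicycle e C, (u, v) \in C & (v, w) \in C].
Proof.
move=> e0 /and3P[euv evw].
have wv : w != v by apply: contraTneq evw => ->; rewrite e0.
case/connectP => p0 /shortenP[p ep up _] uE.
have [epath vNp] : path e w p /\ v \notin p.
  clear up uE wv evw; elim: p w ep => //= y p IHp w.
  case/andP=> /and3P[ewy _ yv] /IHp[-> vp].
  by rewrite ewy inE negb_or eq_sym yv.
have uc : uniq (v :: w :: p) by rewrite cons_uniq inE negb_or eq_sym wv vNp.
have nv : next [:: v, w & p] v = w by rewrite /= eqxx.
have nu : next [:: v, w & p] u = v.
  (* [u] ends the cyclic list whose head is [v], so it is the predecessor of [v]. *)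
  have -> : u = prev [:: v, w & p] v.
    rewrite uE /= eq_sym (negPf wv).
    clear up uE ep epath uc nv wv evw; elim: p w vNp => [|y p IHp] w /=.
      by rewrite eqxx.
    by rewrite inE negb_or => /andP[/negPf-> /IHp].
  by rewrite next_prev.
exists [set (x, next [:: v, w & p] x) | x in [:: v, w & p]]; split.
- exists [:: v, w & p]; split => //.
  by rewrite /ucycle /= rcons_path evw epath -uE euv.
- by apply/imsetP; exists u; rewrite ?nu // uE inE mem_last orbT.
- by apply/imsetP; exists v; rewrite ?nv ?mem_head.
Qed.

Lemma dicycle_functional (n : nat) (e : rel 'I_n) C (u u' v v' : 'I_n) :
  dicycle e C -> (u, v) \in C -> (u', v') \in C -> (u == u') = (v == v').
Proof.
case=> c [_ /andP[_ uc] ->] /imsetP[x _ [-> ->]] /imsetP[y _ [-> ->]].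
by rewrite (can_eq (prev_next uc)).
Qed.

(** Two matched pairs at [v] that share an edge lie on the same cycle by uniqueness, and a cycle has
    only one edge into and one edge out of [v]. *)
Lemma cactus_cycle_matching (n : nat) (e : rel 'I_n) :
  directed_cactus e -> cycle_matching e.
Proof.
case=> e0 _ ue v u u' w w' m m'.
have [C [cC uC wC]] := matched_dicycle e0 m.
have [C' [cC' uC' wC']] := matched_dicycle e0 m'.
have uniqC a b : (a, b) \in C -> (a, b) \in C' -> C = C'.
  move=> abC abC'; have eab : e a b.
    case: cC abC => c [_ /andP[cc _] ->] /imsetP[x xc [-> ->]].
    exact: next_cycle cc xc.
  by have [D [_ Du]] := ue _ _ eab; rewrite -(Du C) ?(Du C').
apply/eqP/eqP => E.
  have CC : C = C' by apply: (uniqC u v); rewrite // E.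
  rewrite -CC in wC'; have := dicycle_functional cC wC wC'.
  by rewrite eqxx => /esym/eqP.
have CC : C = C' by apply: (uniqC v w); rewrite // E.
rewrite -CC in uC'; have := dicycle_functional cC uC uC'.
by rewrite eqxx => /eqP.
Qed.

(** * Balance, and the cut defined by an edge *)

Lemma strongly_connected_converse (n : nat) (e : rel 'I_n) :
  strongly_connected e -> strongly_connected (converse e).
Proof. by move=> ce i j; rewrite (connect_converse e). Qed.

Lemma exists_matched (n : nat) (e : rel 'I_n) (v w : 'I_n) :
  irreflexive e -> strongly_connected e -> e v w -> exists u, matched e v u w.
Proof.
move=> e0 ce evw; have wv : w != v by apply: contraTneq evw => ->; rewrite e0.
have [u euv cwu] := connect_first_arrival (ce w v) wv.
by exists u; apply/and3P.
Qed.

(** Sending an out-neighbour [w] to a matched in-neighbour is injective. The default value in [f] is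
    never reached on out-neighbours. *)
Lemma outdeg_le_indeg (n : nat) (e : rel 'I_n) (v : 'I_n) :
  irreflexive e -> strongly_connected e -> cycle_matching e ->
  (outdeg e v <= outdeg (converse e) v)%N.
Proof.
move=> e0 ce Me; pose f w := odflt w [pick u | matched e v u w].
have fP w : e v w -> matched e v (f w) w.
  move=> /(exists_matched e0 ce)[u m]; rewrite /f.
  by case: pickP => [//|/(_ u)]; rewrite m.
have <- : #|[set f w | w in [set w | e v w]]| = outdeg e v.
  apply: card_in_imset => w w'; rewrite !inE => /fP m /fP m' E.
  by apply/eqP; rewrite -(Me _ _ _ _ _ m m') E.
apply/subset_leq_card/subsetP => u /imsetP[w]; rewrite !inE => /fP m ->.
by case/and3P: m.
Qed.

Lemma cycle_matching_balanced (n : nat) (e : rel 'I_n) (v : 'I_n) :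
  irreflexive e -> strongly_connected e -> cycle_matching e ->
  outdeg (converse e) v = outdeg e v.
Proof.
move=> e0 ce Me; apply/eqP; rewrite eqn_leq outdeg_le_indeg // andbT.
apply: outdeg_le_indeg => //; first exact: strongly_connected_converse.
exact: cycle_matching_converse.
Qed.

(* Otherwise the path leaves i through some w != j, and the cycle through
   (i, j) would return to i along the same edge as a cycle through (i, w). *)
Lemma edge_bridge (n : nat) (e : rel 'I_n) (i j : 'I_n) :
  irreflexive e -> strongly_connected e -> cycle_matching e -> e i j ->
  ~~ connect (remove_edge e i j) i j.
Proof.
move=> e0 ce Me eij; apply/negP => cij.
have ij : i != j by apply: contraTneq eij => ->; rewrite e0.
have [w /andP[eiw]] := connect_last_departure cij ij.
rewrite xpair_eqE eqxx /= => wj.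
move/(sub_connect_avoid (@sub_remove_edge _ e i j)) => cwj.
have [u m] := exists_matched e0 ce eij; have /and3P[eui _ cju] := m.
have m' : matched e i u w by apply/and3P; split=> //; apply: connect_trans cju.
by move: (Me _ _ _ _ _ m' m); rewrite eqxx (negPf wj).
Qed.

(* k is the successor of j on the cycle through (i, j). *)
Lemma exists_exit (n : nat) (e : rel 'I_n) (i j : 'I_n) :
  irreflexive e -> strongly_connected e -> cycle_matching e -> e i j ->
  exists2 k, e j k & ~~ connect (remove_edge e i j) k j.
Proof.
move=> e0 ce Me eij.
have [k] := exists_matched (e := converse e) e0
  (strongly_connected_converse ce) eij.
rewrite (matched_converse e) => m; have /and3P[_ ejk _] := m; exists k => //.
have kj : k != j by apply: contraTneq ejk => ->; rewrite e0.
apply/negP => /connect_first_arrival/(_ kj)[u /andP[euj]].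
rewrite xpair_eqE eqxx andbT => ui.
move/(sub_connect_avoid (@sub_remove_edge _ e i j)) => cku.
have m' : matched e j u k by apply/and3P.
by move: (Me _ _ _ _ _ m' m); rewrite eqxx (negPf ui).
Qed.

(** * The Laplacian: minimum principle and kernel *)

Lemma laplacian_mulE (R : realFieldType) (n : nat) (e : rel 'I_n)
    (x : 'cV[R]_n) (v : 'I_n) : irreflexive e ->
  (laplacian R e *m x) v 0 = \sum_(w | e v w) (x v 0 - x w 0).
Proof.
move=> e0; rewrite sumrB sumr_const !mxE (bigD1 v) //= mxE eqxx.
rewrite /outdeg cardsE mulr_natl; congr (_ + _).
rewrite [in RHS]big_mkcond [in RHS](bigD1 v) //= e0 add0r -sumrN.
apply: eq_bigr => w wv; rewrite mxE eq_sym (negPf wv).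
by case: (e v w); rewrite ?mulN1r ?mul0r ?oppr0.
Qed.

(** At a minimiser other than [j] the differences [x v 0 - x w 0] are nonpositive with nonnegative
    sum, so every out-neighbour is a minimiser too. Following a path to [j] carries the minimum
    there. *)
Lemma laplacian_min_principle (R : realFieldType) (n : nat) (e : rel 'I_n)
    (x : 'cV[R]_n) (j : 'I_n) :
  irreflexive e -> strongly_connected e ->
  (forall v, v != j -> 0 <= (laplacian R e *m x) v 0) ->
  forall i, x j 0 <= x i 0.
Proof.
move=> e0 ce Lx_ge0.
case: (Order.TotalTheory.arg_minP (fun v => x v 0) (erefl : xpredT j)).
move=> m _ min_m.
suff xjm : x j 0 = x m 0 by move=> i; rewrite xjm; exact: min_m.
case/connectP: (ce m j) => p.
have : x m 0 = x m 0 by [].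
(* Only the start of the path is generalised, to any vertex attaining the minimum; [m] stays as the
   reference value. *)
move: {1 3 4}m => v; elim: p v => [|w p IHp] v /= xv; first by move=> _ ->.
case/andP => evw ep jE; have [<- //|/Lx_ge0] := eqVneq v j.
rewrite laplacian_mulE // => S_ge0; apply: IHp ep jE.
have ge0 u : e v u -> 0 <= x u 0 - x v 0 by rewrite xv subr_ge0 min_m.
have S_le0 : \sum_(u | e v u) (x u 0 - x v 0) <= 0.
  rewrite -oppr_ge0 -sumrN; apply: le_trans S_ge0 _.
  by apply: ler_sum => u _; rewrite opprB.
have /eqP : \sum_(u | e v u) (x u 0 - x v 0) = 0.
  by apply/le_anti; rewrite S_le0 sumr_ge0.
rewrite psumr_eq0 // => /allP/(_ w (mem_index_enum w)).
by rewrite evw /= subr_eq0 xv => /eqP.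
Qed.

Lemma laplacian_const (R : realFieldType) (n : nat) (e : rel 'I_n) :
  irreflexive e -> laplacian R e *m const_mx 1 = 0 :> 'cV[R]_n.
Proof.
move=> e0; apply/matrixP => v k; rewrite ord1 laplacian_mulE // [RHS]mxE.
by rewrite big1 // => w _; rewrite !mxE subrr.
Qed.

Lemma laplacian_ker (R : realFieldType) (n : nat) (e : rel 'I_n)
    (x : 'cV[R]_n) :
  irreflexive e -> strongly_connected e -> laplacian R e *m x = 0 ->
  forall i j, x i 0 = x j 0.
Proof.
move=> e0 ce Lx0 i j.
have le_x k : forall l, x k 0 <= x l 0.
  by apply: (laplacian_min_principle e0 ce) => v _; rewrite Lx0 mxE.
by apply/le_anti; rewrite !le_x.
Qed.

(** * The Moore-Penrose inverse of the Laplacian *)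

Lemma moore_penrose_laplacianK (R : realFieldType) (n : nat) (e : rel 'I_n)
    (X : 'M[R]_n) :
  irreflexive e -> strongly_connected e -> is_moore_penrose (laplacian R e) X ->
  X *m laplacian R e = 1%:M - const_mx n%:R^-1.
Proof.
move=> e0 ce [LXL _ _ XLT]; set L := laplacian R e in LXL XLT *.
(* [D] projects onto the kernel of [L]: its columns are constant, by symmetry all its entries agree,
   and fixing the all-ones vector makes them 1/n. *)
pose D := 1%:M - X *m L.
have DT : D^T = D by rewrite /D linearB /= XLT trmx1.
have LD : L *m D = 0 by rewrite mulmxBr mulmx1 mulmxA LXL subrr.
have Dcol i j k : D i k = D j k.
  have := laplacian_ker (x := col k D) e0 ce; rewrite colE mulmxA -/L LD mul0mx.
  by move/(_ erefl i j); rewrite -colE !mxE.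
have D1 : D *m const_mx 1 = const_mx 1 :> 'cV_n.
  by rewrite mulmxBl mul1mx -mulmxA laplacian_const // mulmx0 subr0.
have -> : X *m L = 1%:M - D by rewrite opprB addrC subrK.
have Dsym a b : D a b = D b a by rewrite -[in LHS]DT [LHS]mxE.
congr (_ - _); clearbody D; apply/matrixP => i k; rewrite [RHS]mxE.
have n0 : n%:R != 0 :> R.
  by rewrite pnatr_eq0 -lt0n (leq_ltn_trans _ (ltn_ord i)).
have /matrixP/(_ i 0) := D1; rewrite !mxE => D1i; apply: (mulIf n0).
rewrite mulVf // -[RHS]D1i (eq_bigr (fun=> D i k)) => [|l _].
  by rewrite sumr_const card_ord mulr_natr.
by rewrite [const_mx _ _ _]mxE mulr1 (Dsym i l) (Dcol l k) (Dsym k i).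
Qed.

Lemma is_moore_penrose_tr (R : realFieldType) (m n : nat)
    (A : 'M[R]_(m, n)) (X : 'M[R]_(n, m)) :
  is_moore_penrose A X -> is_moore_penrose A^T X^T.
Proof.
case=> AXA XAX AXT XAT.
by split; rewrite -!trmx_mul ?mulmxA ?AXA ?XAX // ?AXT ?XAT.
Qed.

Lemma laplacian_converse (R : realFieldType) (n : nat) (e : rel 'I_n) :
  (forall v, outdeg (converse e) v = outdeg e v) ->
  laplacian R (converse e) = (laplacian R e)^T.
Proof.
move=> bal; apply/matrixP => i j; rewrite !mxE eq_sym /converse.
by have [->|//] := eqVneq; rewrite -bal.
Qed.

(** * The indicator of the cut *)

Definition indicator (R : realFieldType) (n : nat) (P : pred 'I_n) : 'cV[R]_n :=
  \col_v (P v)%:R.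

(* The entries of either side sum to 0, so comparing them one way is enough. *)
Lemma laplacian_indicator (R : realFieldType) (n : nat) (e : rel 'I_n)
    (i j : 'I_n) (P := fun v => connect (remove_edge e i j) v j) :
  irreflexive e -> strongly_connected e -> cycle_matching e -> e i j ->
  laplacian R e *m indicator R P = delta_mx j 0 - delta_mx i 0.
Proof.
move=> e0 ce Me eij.
have Pj : P j by exact: connect0.
have Pi : ~~ P i by exact: edge_bridge.
set x := indicator R P; have xE u : x u 0 = (P u)%:R by rewrite mxE.
clearbody x; pose h := laplacian R e *m x - (delta_mx j 0 - delta_mx i 0).
have h_ge0 v : 0 <= h v 0.
  rewrite mxE laplacian_mulE // !mxE !andbT.
  have [Pv|PNv] := boolP (P v).
    have -> : (v == i) = false by apply: contraTF Pv => /eqP->.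
    rewrite subr0 subr_ge0.
    have ge0 u : e v u -> 0 <= x v 0 - x u 0.
      by rewrite !xE Pv subr_ge0 lern1 leq_b1.
    have [vj|_] := eqVneq v j; last exact: sumr_ge0.
    (* The exit edge from [j] contributes 1, which offsets the subtracted [delta_mx j 0]. *)
    have [k ejk PNk] := exists_exit e0 ce Me eij.
    have {}PNk : P k = false by exact: negPf.
    rewrite -vj in ejk; rewrite (bigD1 k) //= {1}xE xE Pv PNk subr0 lerDl.
    by apply: sumr_ge0 => u /andP[/ge0].
  have vj : v != j by apply: contraNneq PNv => ->.
  (* Any other edge entering [P] would survive the deletion and put its tail [v] in [P]. *)
  have in_edge u : e v u -> P u -> v = i /\ u = j.
    move=> evu Pu; suff /eqP[] : (v, u) == (i, j) by [].
    apply: contraNT PNv => NE; apply: connect_trans Pu.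
    exact/connect1/andP.
  have [vi|vi] := eqVneq v i.
    rewrite (negPf vj) sub0r opprK (bigD1 j) ?vi //= big1 => [|u /andP[eiu uj]].
      by rewrite !xE Pj (negPf Pi) sub0r addr0 addNr.
    rewrite !xE (negPf Pi); case: (boolP (P u)) => [Pu|]; last by rewrite subrr.
    by have [|_ /eqP] := in_edge u _ Pu; rewrite ?vi // (negPf uj).
  rewrite (negPf vj) subrr subr0; apply: sumr_ge0 => u evu.
  rewrite !xE (negPf PNv) sub0r oppr_ge0 lern0 eqb0.
  by apply/negP => /(in_edge u evu)[/eqP]; rewrite (negPf vi).
have h_sum : \sum_v h v 0 = 0.
  (* By balance the reversed digraph has the transposed Laplacian, so the columns of [laplacian R e]
     also sum to 0. *)
  have L1 := laplacian_const R (e := converse e) e0.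
  rewrite laplacian_converse in L1; last first.
    by move=> v; exact: cycle_matching_balanced.
  have : (const_mx 1 : 'rV_n) *m h = 0.
    rewrite mulmxBr mulmxA -[_ *m laplacian R e]trmxK trmx_mul trmx_const L1.
    rewrite trmx0 mul0mx.
    apply/matrixP => a b; rewrite ord1 [b]ord1 mulmxBr !mxE.
    have D k :
        \sum_v (const_mx 1 : 'rV[R]_n) 0 v * (delta_mx k 0 : 'cV_n) v 0 = 1.
      rewrite (bigD1 k) //= big1 => [|u uk].
        by rewrite !mxE !eqxx mulr1 addr0.
      by rewrite !mxE (negPf uk) mulr0.
    by rewrite !D !subrr.
  move/matrixP/(_ 0 0); clearbody h; rewrite !mxE => hE; rewrite -[RHS]hE.
  by apply: eq_bigr => v _; rewrite [const_mx _ _ _]mxE mul1r.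
apply/eqP; rewrite -subr_eq0; apply/eqP/matrixP => v k; rewrite ord1 [RHS]mxE.
apply/eqP; move/eqP: h_sum; rewrite psumr_eq0 //.
by move/allP/(_ v (mem_index_enum v)).
Qed.

(** * Resistance of an edge, triangle inequality and conclusion *)

Lemma moore_penrose_edge (R : realFieldType) (n : nat) (e : rel 'I_n)
    (X : 'M[R]_n) (i j : 'I_n) :
  irreflexive e -> strongly_connected e -> cycle_matching e -> e i j ->
  is_moore_penrose (laplacian R e) X ->
  X i i - X i j = #|[set v | connect (remove_edge e i j) v j]|%:R / n%:R.
Proof.
move=> e0 ce Me eij MX.
have /(congr1 (mulmx X)) := laplacian_indicator R e0 ce Me eij.
rewrite mulmxA moore_penrose_laplacianK // mulmxBl mul1mx mulmxBr -!colE.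
(* In row [i] the indicator vanishes, as [i] is cut off from [j]; only the averaging term
   remains. *)
move/matrixP/(_ i 0); rewrite !mxE (negPf (edge_bridge e0 ce Me eij)) sub0r.
move/(congr1 -%R); rewrite opprK opprB => <-.
rewrite -sum1_card natr_sum mulr_suml [RHS]big_mkcond /=.
apply: eq_bigr => v _; rewrite !mxE inE mulrC.
by case: connect; rewrite ?mul0r.
Qed.

Lemma resistance_edge (R : realFieldType) (n : nat) (e : rel 'I_n)
    (X : 'M[R]_n) (i j : 'I_n) :
  irreflexive e -> strongly_connected e -> cycle_matching e -> e i j ->
  is_moore_penrose (laplacian R e) X -> resistance X i j <= 1.
Proof.
move=> e0 ce Me eij MX.
have XiE := moore_penrose_edge e0 ce Me eij MX.
have XjE : X j j - X i j =
    #|[set v | connect (remove_edge e i j) i v]|%:R / n%:R.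
  have MXT : is_moore_penrose (laplacian R (converse e)) X^T.
    rewrite laplacian_converse; first exact: is_moore_penrose_tr.
    by move=> v; exact: cycle_matching_balanced.
  have := moore_penrose_edge (e := converse e) (i := j) (j := i) e0
    (strongly_connected_converse ce) (cycle_matching_converse Me) eij MXT.
  rewrite !mxE => ->; congr (_%:R / _); apply: eq_card => v; rewrite !inE.
  rewrite -(connect_converse (remove_edge e i j)); apply: eq_connect => a b.
  by rewrite /remove_edge /converse !xpair_eqE andbC [(a == j) && _]andbC andbC.
have -> : resistance X i j = (X i i - X i j) + (X j j - X i j).
  by rewrite /resistance mulr_natl mulr2n addrACA opprD.
(* Inclusion-exclusion: a common vertex would give a path from [i] to [j] avoiding the deleted
   edge. *)
rewrite XiE XjE -mulrDl -natrD -cardsUI.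
set I := _ :&: _; have -> : I = set0.
  apply/setP => v; rewrite !inE; apply/negP => /andP[vj iv].
  by have /negP[] := edge_bridge e0 ce Me eij; exact: connect_trans iv vj.
rewrite cards0 addn0 ler_pdivrMr ?mul1r ?ler_nat; last first.
  by rewrite ltr0n (leq_ltn_trans _ (ltn_ord i)).
by rewrite -[leqRHS]card_ord max_card.
Qed.

(** The potential [x] with source [k] and sink [j] satisfies the minimum principle off [j]. The
    inequality [x j 0 <= x i 0] is half of the claim, without any symmetry of [X]. *)
Lemma resistance_triangle (R : realFieldType) (n : nat) (e : rel 'I_n)
    (X : 'M[R]_n) (i j k : 'I_n) :
  irreflexive e -> strongly_connected e ->
  (forall v, outdeg (converse e) v = outdeg e v) ->
  is_moore_penrose (laplacian R e) X ->
  resistance X i k <= resistance X i j + resistance X j k.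
Proof.
move=> e0 ce bal MX.
have LX : laplacian R e *m X = 1%:M - const_mx n%:R^-1.
  have MXT : is_moore_penrose (laplacian R (converse e)) X^T.
    by rewrite laplacian_converse //; exact: is_moore_penrose_tr.
  have := moore_penrose_laplacianK (e := converse e) e0
    (strongly_connected_converse ce) MXT.
  rewrite laplacian_converse // -trmx_mul => /(congr1 trmx).
  by rewrite trmxK linearB /= trmx1 trmx_const.
pose x : 'cV_n := X *m (delta_mx k 0 - delta_mx j 0).
have xE v : x v 0 = X v k - X v j by rewrite /x mulmxBr -!colE !mxE.
have : x j 0 <= x i 0.
  apply: (laplacian_min_principle e0 ce) => v vj.
  rewrite mulmxA LX mulmxBr -!colE !mxE.
  by rewrite (negPf vj) sub0r opprK subrK ler0n.
rewrite !xE -subr_ge0 => xge0; rewrite -subr_ge0.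
set d := (X in 0 <= X) in xge0.
have -> : resistance X i j + resistance X j k - resistance X i k = d + d.
  rewrite /resistance /d; ring.
by rewrite addr_ge0.
Qed.

Theorem theorem3p5 (R : realFieldType) (n : nat) (e : rel 'I_n)
    (cactus_e : directed_cactus e)
    (Ldag : 'M[R]_n) (LdagP : is_moore_penrose (laplacian R e) Ldag)
    (i j : 'I_n) :
  resistance Ldag i j <= (didist e i j)%:R.
Proof.
have [e0 ce _] := cactus_e; have Me := cactus_cycle_matching cactus_e.
have [[p /and3P[ep /eqP pj _] <-] _] := didistP (ce i j).
(* The induction bounds the resistance by the length of a walk, with the start [i] generalised so
   that it applies to the tail from [k]. *)
elim: p i ep pj => [|k p IHp] i /= => [_ ->|/andP[eik ep] pj].
  by rewrite /resistance mulr_natl mulr2n subrr.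
have bal v := cycle_matching_balanced v e0 ce Me.
apply: le_trans (resistance_triangle i k j e0 ce bal LdagP) _.
by rewrite -add1n natrD lerD ?(resistance_edge e0 ce Me eik LdagP) ?IHp.
Qed.
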